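(* Let $M$ be an $n\times n$ symmetric matrix over $\mathbb{GF}(2)$ with rows and columns indexed by a finite set $V$. Let $u,v\in V$ be distinct and $V'=V\setminus\{u,v\}$. Suppose that $$M=\begin{bmatrix}1&1&P^T\\1&0&Q^T\\P&Q&N\end{bmatrix},$$ where the block rows and block columns are indexed by $\{u\}$, $\{v\}$ and $V'$. Then $$P_{\langle\delta\tau\delta\rangle}(M,z)=z^{\operatorname{rank}(M)}\Big(z^{-\operatorname{rank}(M_v)}P_{\langle\delta\tau\delta\rangle}(M_v,z)+z^{-\operatorname{rank}(N+QQ^T)}P_{\langle\delta\tau\delta\rangle}(N+QQ^T,z)+z^{-\operatorname{rank}(L)}P_{\langle\delta\tau\delta\rangle}(L,z)\Big),$$ where $M_v=M[V\setminus\{v\}]$ and $L=N+PP^T+QP^T+PQ^T$.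
   Context: All matrices are over $\mathbb{GF}(2)$. For a square matrix $C$ with rows and columns indexed by a finite set $W$, the partial-$\langle\delta\tau\delta\rangle$ polynomial of $C$ is $$P_{\langle\delta\tau\delta\rangle}(C,z)=\sum_{A\subseteq W}z^{\operatorname{rank}(C)-\operatorname{corank}((C+I_A)[A])},$$ where $I_A$ is the diagonal matrix indexed by $W$ with diagonal entry $1$ at indices in $A$ and $0$ otherwise, $C[A]$ denotes the principal submatrix of $C$ on $A$, and the corank of a $k\times k$ matrix is $k$ minus its rank. The empty matrix has rank and corank $0$ (so its polynomial is $1$). The matrices $N$, $N+QQ^T$ and $L$ are indexed by $V'$. Identities are understood in the ring of Laurent polynomials in $z$. *)

(* Defs.v *)
From mathcomp Require Import all_boot all_order all_algebra.

Set Implicit Arguments.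
Unset Strict Implicit.
Unset Printing Implicit Defensive.

Import GRing.Theory.
Local Open Scope ring_scope.

(* Square matrices over GF(2) indexed by an arbitrary finite type W, as opposed
   to 'M['F_2]_n, whose index type is 'I_n. *)
Notation gf2mx W := {ffun W * W -> 'F_2}.
Notation gf2vec W := {ffun W -> 'F_2}.

(* The library matrix obtained by listing W in its enumeration order; the rank
   does not depend on that order. *)
Definition to_mx (W : finType) (C : gf2mx W) : 'M['F_2]_#|W| :=
  \matrix_(i, j) C (enum_val i, enum_val j).

Definition mrank (W : finType) (C : gf2mx W) : nat := \rank (to_mx C).

Definition mcorank (W : finType) (C : gf2mx W) : nat := (#|W| - mrank C)%N.

Definition symmetric_mx (W : finType) (C : gf2mx W) : Prop :=
  forall x y : W, C (x, y) = C (y, x).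

(* The principal submatrix C[A], indexed by the subtype of elements of A. *)
Definition principal (W : finType) (C : gf2mx W) (A : {set W}) :
    gf2mx {x : W | x \in A} :=
  [ffun p => C (val p.1, val p.2)].

Definition diag_ind (W : finType) (A : {set W}) : gf2mx W :=
  [ffun p => ((p.1 == p.2) && (p.1 \in A))%:R].

(* The product x y^T of two column vectors. *)
Definition outer (W : finType) (x y : gf2vec W) : gf2mx W :=
  [ffun p => x p.1 * y p.2].

(* Laurent polynomials in z with integer coefficients are handled inside the
   field Q(z) of fractions of Z[z], in which Z[z, z^-1] is the subring generated
   by z and z^-1. *)
Definition zvar : {fraction {poly int}} := FracField.tofrac ('X : {poly int}).

Definition partial_dtd (W : finType) (C : gf2mx W) : {fraction {poly int}} :=
  \sum_(A : {set W})
    zvar ^ ((mrank C)%:Z - (mcorank (principal (C + diag_ind A) A))%:Z).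

(* Main.v *)
(** Dividing by z^rank, the claim concerns S(C) = sum_A z^(-corank((C+I_A)[A])).
    Split the sets A of S(M) by their trace on {u, v}. Those without v give
    S(M_v). If v is in A and u is not, the (v, v) entry of M + I_A is 1 and the
    Schur complement at v, which has the same corank, is a term of S(N+QQ^T).
    If both are in A, the Schur complement at v turns the (u, u) entry from 0
    into 1, and a second one, at u, gives a term of S(L). *)

Require Import Defs.
From mathcomp Require Import all_boot all_order all_algebra.
From mathcomp Require Import mxabelem ring.
Import GRing.Theory.
Local Open Scope ring_scope.

Set Implicit Arguments.
Unset Strict Implicit.
Unset Printing Implicit Defensive.

(* Row vectors x with x C = 0; counting them makes the corank insensitive to the
   enumeration order hidden in [to_mx]. *)
Definition lker (W : finType) (C : gf2mx W) : {set gf2vec W} :=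
  [set x : gf2vec W | [forall j, \sum_i x i * C (i, j) == 0]].

Lemma lkerP (W : finType) (C : gf2mx W) (x : gf2vec W) :
  reflect (forall j, \sum_i x i * C (i, j) = 0) (x \in lker C).
Proof. by rewrite inE; apply: (iffP forallP) => xC j; apply/eqP. Qed.

(** The row space of [kermx (to_mx C)] has dimension [mcorank C] over a field with two elements, and
    [h], which lists a vector in enumeration order, maps [lker C] bijectively onto it. *)
Lemma card_lker (W : finType) (C : gf2mx W) :
  #|lker C| = (2 ^ mcorank C)%N.
Proof.
have -> : (2 ^ mcorank C)%N = #|rowg (kermx (to_mx C))|.
  by rewrite card_rowg card_Fp // mxrank_ker.
pose h (x : gf2vec W) : 'rV['F_2]_#|W| := \row_i x (enum_val i).
have h_inj : injective h.
  move=> x y /rowP exy; apply/ffunP => i.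
  by have := exy (enum_rank i); rewrite !mxE enum_rankK.
rewrite -(card_imset _ h_inj); apply: eq_card => r; rewrite mem_rowg.
have kerE (x : gf2vec W) : (h x <= kermx (to_mx C))%MS = (x \in lker C).
  apply/sub_kermxP/lkerP => [/rowP xC j | xC].
    have := xC (enum_rank j); rewrite !mxE (big_enum_val (A := W)) /= => xCj.
    by rewrite -[RHS]xCj; apply: eq_bigr => i _; rewrite !mxE enum_rankK.
  apply/rowP => j; rewrite !mxE -[RHS](xC (enum_val j)).
  rewrite (big_enum_val (A := W)) /=.
  by apply: eq_bigr => i _; rewrite !mxE.
apply/imsetP/idP => [[x xC ->] | rC]; first by rewrite kerE.
have rE : r = h [ffun i => r ord0 (enum_rank i)].
  by apply/rowP => i; rewrite !mxE ffunE enum_valK.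
by exists [ffun i => r ord0 (enum_rank i)] => //; rewrite -kerE -rE.
Qed.

(** Powers of 2 determine their exponents, so a bijection of left kernels suffices to compare
    coranks across different index types. *)
Lemma eq_mcorank (W1 W2 : finType) (C1 : gf2mx W1) (C2 : gf2mx W2) :
  #|lker C1| = #|lker C2| -> mcorank C1 = mcorank C2.
Proof. by rewrite !card_lker => /expnI->. Qed.

Lemma mcorank_reindex (T W : finType) (C : gf2mx W) (f : T -> W) :
  bijective f ->
  mcorank C = mcorank ([ffun p => C (f p.1, f p.2)] : gf2mx T).
Proof.
move=> [g fK gK]; apply: eq_mcorank.
have res_inj : injective (fun x : gf2vec W => [ffun i => x (f i)] : gf2vec T).
  move=> x y /ffunP exy; apply/ffunP => i.
  by have := exy (g i); rewrite !ffunE gK.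
have kerE (x : gf2vec W) : ([ffun i => x (f i)] \in
    lker [ffun p => C (f p.1, f p.2)]) = (x \in lker C).
  have sumE j : \sum_i x i * C (i, f j) =
      \sum_i [ffun i => x (f i)] i * [ffun p => C (f p.1, f p.2)] (i, j).
    rewrite (reindex f); last by exists g => i _; rewrite ?fK ?gK.
    by apply: eq_bigr => i _; rewrite !ffunE.
  apply/lkerP/lkerP => xC j; last by rewrite -sumE.
  by rewrite -[j]gK sumE.
rewrite -(card_imset _ res_inj); apply: eq_card => y.
apply/imsetP/idP => [[x xC ->] | yC]; first by rewrite kerE.
have yE : y = [ffun i => [ffun j => y (g j)] (f i)] :> gf2vec T.
  by apply/ffunP => i; rewrite !ffunE fK.
by exists [ffun j => y (g j)] => //; rewrite -kerE -yE.
Qed.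

(** Frees [C[A]] from its subtype: [T] may be a nested subtype, or an option type whose [None] marks
    a pivot. *)
Lemma mcorank_principal (T W : finType) (C : gf2mx W) (A : {set W})
    (f : T -> W) :
  injective f -> f @: setT = A ->
  mcorank (principal C A) = mcorank ([ffun p => C (f p.1, f p.2)] : gf2mx T).
Proof.
move=> f_inj fA; have fP t : f t \in A by rewrite -fA imset_f.
pose h t : {x : W | x \in A} := exist _ (f t) (fP t).
have h_bij : bijective h.
  apply: inj_card_bij; first by move=> s t [/f_inj].
  by rewrite card_sig -fA card_imset // cardsT.
rewrite (mcorank_reindex _ h_bij).
by congr mcorank; apply/ffunP => p; rewrite !ffunE.
Qed.

Lemma big_option (R : nmodType) (T : finType) (F : option T -> R) :
  \sum_o F o = F None + \sum_t F (Some t).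
Proof.
rewrite (bigD1 None) //=; congr (_ + _).
rewrite (reindex_omap Some id) => [|[]] //=.
by apply: eq_bigl => t; rewrite eqxx.
Qed.

(** As the pivot is 1, column [None] of [x C = 0] determines the coordinate of [x] at [None] from
    the others. Substituting it into the remaining columns leaves the kernel equations of the Schur
    complement, so [ext] is a bijection between the two left kernels. *)
Lemma mcorank_schur (T : finType) (C : gf2mx (option T)) :
  C (None, None) = 1 ->
  mcorank C = mcorank ([ffun p => C (Some p.1, Some p.2) -
    C (Some p.1, None) * C (None, Some p.2)] : gf2mx T).
Proof.
move=> C1; set S := [ffun p => _]; apply: eq_mcorank.
pose ext (x : gf2vec T) : gf2vec (option T) := [ffun o =>
  if o is Some i then x i else - \sum_i x i * C (Some i, None)].
have ext_inj : injective ext.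
  move=> x y /ffunP exy; apply/ffunP => i.
  by have := exy (Some i); rewrite !ffunE.
have extN x : \sum_o ext x o * C (o, None) = 0.
  rewrite big_option ffunE C1 mulr1; apply/eqP; rewrite addrC subr_eq0.
  by apply/eqP/eq_bigr => i _; rewrite ffunE.
have extS x j : \sum_o ext x o * C (o, Some j) = \sum_i x i * S (i, j).
  rewrite big_option ffunE mulNr addrC mulr_suml -sumrB.
  by apply: eq_bigr => i _; rewrite !ffunE /= mulrBr mulrA.
have kerE x : (ext x \in lker C) = (x \in lker S).
  apply/lkerP/lkerP => xC; first by move=> j; rewrite -extS.
  by case=> [j|]; rewrite ?extN ?extS.
rewrite -[RHS](card_imset _ ext_inj); apply: eq_card => y; apply/esym.
apply/imsetP/idP => [[x xC ->] | yC]; first by rewrite kerE.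
have yE : y = ext [ffun i => y (Some i)].
  apply/ffunP => -[i|]; rewrite !ffunE //.
  have /lkerP/(_ None) := yC; rewrite big_option C1 mulr1 => /eqP.
  rewrite addr_eq0 => /eqP->; congr (- _).
  by apply: eq_bigr => i _; rewrite ffunE.
by exists [ffun i => y (Some i)] => //; rewrite -kerE -yE.
Qed.

(** A set whose part outside [D] is [E] is determined by its part inside [D]. That part is taken as
    a set over the subtype of [D], the index type of the smaller matrices. *)
Lemma big_set_trace (R : nmodType) (W : finType) (D E : {set W})
    (F : {set W} -> R) :
  [disjoint E & D] ->
  \sum_(A : {set W} | A :\: D == E) F A =
  \sum_(B : {set {x : W | x \in D}}) F (E :|: val @: B).
Proof.
move=> dED.
have valD (B : {set {x : W | x \in D}}) : val @: B \subset D.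
  by apply/subsetP => _ /imsetP[x _ ->]; apply: valP.
rewrite (reindex_onto (fun B : {set {x : W | x \in D}} => E :|: val @: B)
    (fun A => val @^-1: A)) => /= [|A /eqP <-].
  apply: eq_bigl => B; apply/andP; split; apply/eqP.
    have /setDidPl EDE := dED; have := valD B; rewrite -setD_eq0 => /eqP BD.
    by rewrite setDUl EDE BD setU0.
  apply/setP => x; rewrite !inE mem_imset; last exact: val_inj.
  case: (boolP (val x \in E)) => //= xE.
  by have := valP x; rewrite (disjointFr dED xE).
apply/setP => x; rewrite !inE; case: (boolP (x \in D)) => /= xD.
  apply/imsetP/idP => [[y]|xA]; first by rewrite inE => yA ->.
  by exists (exist _ x xD); rewrite ?inE.
case: (x \in A) => //=; apply/imsetP => -[y _ xy].
by move: xD; rewrite xy (valP y).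
Qed.

(** The sum [S(C)]: [partial_dtd C] with the factor [zvar ^ mrank C] removed, the shape of each
    bracketed summand of the theorem. *)
Definition corank_sum (W : finType) (C : gf2mx W) : {fraction {poly int}} :=
  \sum_(A : {set W}) zvar ^ (- (mcorank (principal (C + diag_ind A) A))%:Z).

Lemma zvar_neq0 : zvar != 0.
Proof. by rewrite /zvar tofrac_eq0 polyX_eq0. Qed.

Lemma partial_dtdE (W : finType) (C : gf2mx W) :
  partial_dtd C = zvar ^ (mrank C)%:Z * corank_sum C.
Proof.
rewrite /partial_dtd mulr_sumr; apply: eq_bigr => A _.
by rewrite expfzDr // zvar_neq0.
Qed.

Lemma corank_sumE (W : finType) (C : gf2mx W) :
  zvar ^ (- (mrank C)%:Z) * partial_dtd C = corank_sum C.
Proof.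
by rewrite partial_dtdE mulrA -expfzDr ?zvar_neq0 // addNr expr0z mul1r.
Qed.

Unset Implicit Arguments.
Set Strict Implicit.
Set Printing Implicit Defensive.

Theorem theorem4p2 (V : finType) (M : gf2mx V) (u v : V)
  (V' := [set: V] :\: [set u; v])
  (P Q : gf2vec {x : V | x \in V'}) (N : gf2mx {x : V | x \in V'})
  (Msym : symmetric_mx M) (uv : u != v)
  (Muu : M (u, u) = 1) (Muv : M (u, v) = 1)
  (Mvu : M (v, u) = 1) (Mvv : M (v, v) = 0)
  (MuP : forall y : {x : V | x \in V'}, M (u, val y) = P y)
  (MvQ : forall y : {x : V | x \in V'}, M (v, val y) = Q y)
  (MPu : forall x : {x : V | x \in V'}, M (val x, u) = P x)
  (MQv : forall x : {x : V | x \in V'}, M (val x, v) = Q x)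
  (MN : forall x y : {x : V | x \in V'}, M (val x, val y) = N (x, y)) :
  let Mv := principal M ([set: V] :\ v) in
  let NQ := N + outer Q Q in
  let L := N + outer P P + outer Q P + outer P Q in
  partial_dtd M =
  zvar ^ (mrank M)%:Z *
    (zvar ^ (- (mrank Mv)%:Z) * partial_dtd Mv
     + zvar ^ (- (mrank NQ)%:Z) * partial_dtd NQ
     + zvar ^ (- (mrank L)%:Z) * partial_dtd L).
Proof.
move=> Mv NQ L; rewrite !corank_sumE partial_dtdE; congr (_ * _).
have setT_imset (T W : finType) (A : {set T}) (f : T -> W)
    (g : {x | x \in A} -> W) :
    (forall x, g x = f (val x)) -> g @: setT = f @: A.
  move=> gE; apply/setP => y; apply/imsetP/imsetP => -[x xA ->].
    by exists (val x); [apply: valP | rewrite gE].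
  by exists (exist _ x xA); rewrite ?inE // gE.
have NV' (y : {x | x \in V'}) : (val y != u) * (val y != v).
  by have := valP y; rewrite !inE andbT negb_or => /andP[-> ->].
(* Puts the trace on [{u, v}] in the form that [big_set_trace] takes with [D := V']. *)
have trace A : A :\: V' = A :&: [set u; v] by rewrite /V' setTD setDE setCK.
have opp2 (a : 'F_2) : - a = a by apply: oppr_pchar2; apply: pchar_Fp.
have two0 : 2%:R = 0 :> 'F_2 by apply/eqP.
have vu : v != u by rewrite eq_sym.
rewrite /corank_sum (bigID (fun A : {set V} => v \notin A)) -addrA /=.
congr (_ + _).
  (* Sets avoiding [v]: the submatrices of [M] and [Mv] agree entry by entry, without any
     pivoting. *)
  rewrite (eq_bigl (fun A => A :\: ([set: V] :\ v) == set0)); last first.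
    by move=> A; rewrite setD_eq0 subsetD1 subsetT.
  rewrite big_set_trace; last by rewrite -setI_eq0 set0I.
  apply: eq_bigr => B _; rewrite set0U; congr (_ ^ - _%:Z).
  rewrite (@mcorank_principal {x | x \in B} _ _ _ (fun x => val (val x))).
  - congr mcorank; apply/ffunP => -[x y]; rewrite !ffunE /=.
    by rewrite mem_imset //; apply: val_inj.
  - by move=> x y /val_inj/val_inj.
  - exact: setT_imset.
rewrite (bigID (fun A : {set V} => u \notin A)) /=; congr (_ + _).
  (* Sets containing [v] but not [u]. *)
  rewrite (eq_bigl (fun A => A :\: V' == [set v])); last first.
    move=> A; rewrite negbK trace; apply/andP/eqP=> [[vA uA]|].
      apply/setP => x; rewrite !inE.
      case: eqP => [->|_]; first by rewrite (negPf uA) (negPf uv).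
      by case: eqP => [->|_]; rewrite ?vA ?andbF.
    move=> /setP AE; have := AE u; have := AE v.
    by rewrite !inE !eqxx orbT !andbT (negPf uv) => -> ->.
  rewrite big_set_trace; last by rewrite disjoints1 !inE eqxx orbT.
  apply: eq_bigr => B _; congr (_ ^ - _%:Z).
  (* The pivot [v] sits at [None]; its diagonal entry is 0 in [M] and becomes 1 because [v] is in
     [A]. *)
  pose f (o : option {x | x \in B}) := oapp (fun x => val (val x)) v o.
  rewrite (@mcorank_principal _ _ _ _ f).
  - rewrite mcorank_schur; last by rewrite !ffunE /= !inE eqxx Mvv add0r.
    congr mcorank; apply/ffunP => -[x y]; rewrite !ffunE /=.
    move: (sval x) (sval y) => a b; rewrite -![sval _]/(val _) !inE.
    rewrite (negPf (NV' a).2) [v == _]eq_sym (negPf (NV' b).2) /=.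
    rewrite (inj_eq val_inj) mem_imset; last exact: val_inj.
    by rewrite MN MQv MvQ !addr0 /= opp2; ring.
  - case=> [x|] [y|] //=; first by move=> /val_inj/val_inj->.
      by move=> /eqP; rewrite (negPf (NV' (val x)).2).
    by move=> /esym/eqP; rewrite (negPf (NV' (val y)).2).
  - apply/setP => x; rewrite in_setU1; apply/imsetP/orP => [[[y|] _ ->]|].
    + by right; apply: imset_f; apply: valP.
    + by left.
    + case=> [/eqP->|/imsetP[y yB ->]]; first by exists None.
      by exists (Some (exist _ y yB)).
(* Sets containing both [u] and [v]. *)
rewrite (eq_bigl (fun A => A :\: V' == [set u; v])); last first.
  by move=> A; rewrite !negbK trace (sameP eqP setIidPr) subUset !sub1set andbC.
rewrite big_set_trace; last by rewrite /V' setTD -setI_eq0 setICr.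
apply: eq_bigr => B _; congr (_ ^ - _%:Z).
(* The outer [None] is [v], the first pivot; [Some None] is [u], the second. *)
pose f (o : option (option {x | x \in B})) :=
  oapp (oapp (fun x => val (val x)) u) v o.
rewrite (@mcorank_principal _ _ _ _ f).
- rewrite mcorank_schur; last by rewrite !ffunE /= !inE !eqxx orbT Mvv add0r.
  (* After the complement at [v], the [(u, u)] entry is [(1 + 1) - 1 * 1], which is 1 over GF(2). *)
  rewrite mcorank_schur; last first.
    rewrite !ffunE /= !inE !eqxx /= (negPf uv) (negPf vu) /= Muu Mvu Muv.
    by apply/eqP.
  congr mcorank; apply/ffunP => -[x y]; rewrite !ffunE /=.
  move: (sval x) (sval y) => a b; rewrite -![sval _]/(val _) !inE.
  rewrite (negPf (NV' a).1) (negPf (NV' a).2) ![_ == val b]eq_sym.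
  rewrite (negPf (NV' b).1) (negPf (NV' b).2) (negPf uv) (negPf vu).
  rewrite (inj_eq val_inj) [b == a]eq_sym /=.
  rewrite mem_imset; last exact: val_inj.
  (* Up to the diagonal term, the two complements leave [N (a, b) - Q a * Q b - (P a - Q a) * (P b -
     Q b)]. It falls short of the entry of [L] by [P a * P b + Q a * Q b] taken twice; adding this
     zero gives an identity that holds in every commutative ring. *)
  rewrite MN MQv MvQ MPu MuP Muv Mvu !addr0 /= -[LHS]addr0.
  rewrite -(mulr0 (P a * P b + Q a * Q b)) -two0; ring.
- case=> [[x|]|] [[y|]|] //=.
  + by move=> /val_inj/val_inj->.
  + by move=> /eqP; rewrite (negPf (NV' (val x)).1).
  + by move=> /eqP; rewrite (negPf (NV' (val x)).2).
  + by move=> /esym/eqP; rewrite (negPf (NV' (val y)).1).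
  + by move=> /eqP; rewrite (negPf uv).
  + by move=> /esym/eqP; rewrite (negPf (NV' (val y)).2).
  + by move=> /eqP; rewrite (negPf vu).
- apply/setP => x; rewrite in_setU !inE; apply/imsetP/idP => [[[[y|]|] _ ->]|].
  + by apply/orP; right; apply: imset_f; apply: valP.
  + by rewrite eqxx.
  + by rewrite eqxx orbT.
  + case/orP => [/orP[/eqP->|/eqP->]|/imsetP[y yB ->]].
    * by exists (Some None).
    * by exists None.
    * by exists (Some (Some (exist _ y yB))).
Qed.
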